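(* Let $A$ be an object in a cartesian linearly distributive category (CLDC). Then the following are equivalent: (i) $A$ is preinitial; (ii) $A$ is subterminal; (iii) $\pi^0_{A,A};\iota^0_{A,A}=\mathrm{mix}_{A,A}=\pi^1_{A,A};\iota^1_{A,A}$ as maps $A\times A\to A+A$.
   Context: An object $A$ of a category is preinitial if for every object $X$ there is at most one map $A\to X$, and subterminal if for every object $X$ there is at most one map $X\to A$. Composition is written in diagrammatic order: $f;g$ means first $f$, then $g$. For finite products write $\times$, terminal object $\top$, projections $\pi^0,\pi^1$, pairing $\langle -,-\rangle$, $t_A:A\to\top$; for finite coproducts write $+$, initial object $\bot$, injections $\iota^0,\iota^1$, copairing $[-,-]$, $b_A:\bot\to A$. The canonical structure isomorphisms are $\alpha^\times_{A,B,C}:(A\times B)\times C\to A\times(B\times C)$, $r^\times_A:A\to A\times\top$, $l^\times_A:A\to\top\times A$, $\sigma^\times_{A,B}:A\times B\to B\times A$, and $\alpha^+_{A,B,C}:A+(B+C)\to(A+B)+C$, $r^+_A:A+\bot\to A$, $l^+_A:\bot+A\to A$, $\sigma^+_{A,B}:A+B\to B+A$. A cartesian linearly distributive category (CLDC) is a category with finite products and finite coproducts (a symmetric linearly distributive category whose tensor is the product and whose par is the coproduct), equipped with natural transformations (linear distributors) $\delta^R_{A,B,C}:(A+B)\times C\to A+(B\times C)$ and $\delta^L_{A,B,C}:A\times(B+C)\to(A\times B)+C$ such that for all objects: (1) $l^\times_{A+B};\delta^L_{\top,A,B}=l^\times_A+1_B$; $r^\times_{A+B};\delta^R_{A,B,\top}=1_A+r^\times_B$;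 $\delta^R_{\bot,A,B};l^+_{A\times B}=l^+_A\times 1_B$; $\delta^L_{A,B,\bot};r^+_{A\times B}=1_A\times r^+_B$. (2) $\delta^L_{A\times B,C,D};(\alpha^\times_{A,B,C}+1_D)=\alpha^\times_{A,B,C+D};(1_A\times\delta^L_{B,C,D});\delta^L_{A,B\times C,D}$; $(\alpha^+_{A,B,C}\times 1_D);\delta^R_{A+B,C,D}=\delta^R_{A,B+C,D};(1_A+\delta^R_{B,C,D});\alpha^+_{A,B,C\times D}$; $\delta^L_{A,B,C+D};\alpha^+_{A\times B,C,D}=(1_A\times\alpha^+_{B,C,D});\delta^L_{A,B+C,D};(\delta^L_{A,B,C}+1_D)$; $\alpha^\times_{A+B,C,D};\delta^R_{A,B,C\times D}=(\delta^R_{A,B,C}\times 1_D);\delta^R_{A,B\times C,D};(1_A+\alpha^\times_{B,C,D})$. (3) $\delta^L_{A+B,C,D};(\delta^R_{A,B,C}+1_D)=\delta^R_{A,B,C+D};(1_A+\delta^L_{B,C,D});\alpha^+_{A,B\times C,D}$; $(\delta^L_{A,B,C}\times 1_D);\delta^R_{A\times B,C,D}=\alpha^\times_{A,B+C,D};(1_A\times\delta^R_{B,C,D});\delta^L_{A,B,C\times D}$. (4) $\delta^R_{A,B,C}=\sigma^\times_{A+B,C};(1_C\times\sigma^+_{A,B});\delta^L_{C,B,A};(\sigma^\times_{C,B}+1_A);\sigma^+_{B\times C,A}$. Let $m:\bot\to\top$ be the unique map. The mix map $\mathrm{mix}_{A,B}:A\times B\to A+B$ is the composite $(1_A\times (l^+_B)^{-1});(1_A\times(m+1_B));\delta^L_{A,\top,B};((r^\times_A)^{-1}+1_B)$,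 which in every CLDC equals $((r^+_A)^{-1}\times 1_B);((1_A+m)\times 1_B);\delta^R_{A,\top,B};(1_A+(l^\times_B)^{-1})$ (every CLDC is mix). *)

(* Defs.v *)
Set Implicit Arguments.
Unset Strict Implicit.
Unset Printing Implicit Defensive.

Declare Scope cldc_scope.
Delimit Scope cldc_scope with cldc.

(* [comp f g], written [f ;; g], is in diagrammatic order: first [f], then [g]. *)
Record category : Type := Category {
  obj :> Type;
  hom : obj -> obj -> Type;
  id : forall A, hom A A;
  comp : forall A B C, hom A B -> hom B C -> hom A C;
  comp_idl : forall A B (f : hom A B), comp (id A) f = f;
  comp_idr : forall A B (f : hom A B), comp f (id B) = f;
  comp_assoc : forall A B C D (f : hom A B) (g : hom B C) (h : hom C D),
    comp (comp f g) h = comp f (comp g h)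
}.

Arguments hom {c} A B.
Arguments id {c} A.
Arguments comp {c A B C} f g.

Notation "f ;; g" := (comp f g) (at level 52, left associativity) : cldc_scope.

Open Scope cldc_scope.

Definition preinitial (C : category) (A : C) : Prop :=
  forall (X : C) (f g : hom A X), f = g.

Definition subterminal (C : category) (A : C) : Prop :=
  forall (X : C) (f g : hom X A), f = g.

Class products (C : category) : Type := Products {
  top : C;
  to_top : forall A : C, hom A top;
  to_top_unique : forall (A : C) (f : hom A top), f = to_top A;
  prod : C -> C -> C;
  proj0 : forall A B : C, hom (prod A B) A;
  proj1 : forall A B : C, hom (prod A B) B;
  pair : forall X A B : C, hom X A -> hom X B -> hom X (prod A B);
  pair_proj0 : forall (X A B : C) (f : hom X A) (g : hom X B),
    pair f g ;; proj0 A B = f;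
  pair_proj1 : forall (X A B : C) (f : hom X A) (g : hom X B),
    pair f g ;; proj1 A B = g;
  pair_unique : forall (X A B : C) (f : hom X A) (g : hom X B)
      (h : hom X (prod A B)),
    h ;; proj0 A B = f -> h ;; proj1 A B = g -> h = pair f g
}.

Class coproducts (C : category) : Type := Coproducts {
  bot : C;
  from_bot : forall A : C, hom bot A;
  from_bot_unique : forall (A : C) (f : hom bot A), f = from_bot A;
  coprod : C -> C -> C;
  inj0 : forall A B : C, hom A (coprod A B);
  inj1 : forall A B : C, hom B (coprod A B);
  copair : forall A B X : C, hom A X -> hom B X -> hom (coprod A B) X;
  inj0_copair : forall (A B X : C) (f : hom A X) (g : hom B X),
    inj0 A B ;; copair f g = f;
  inj1_copair : forall (A B X : C) (f : hom A X) (g : hom B X),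
    inj1 A B ;; copair f g = g;
  copair_unique : forall (A B X : C) (f : hom A X) (g : hom B X)
      (h : hom (coprod A B) X),
    inj0 A B ;; h = f -> inj1 A B ;; h = g -> h = copair f g
}.

Notation "A * B" := (prod A B) : cldc_scope.
Notation "A + B" := (coprod A B) : cldc_scope.

Definition prod_map (C : category) (P : products C) (A A' B B' : C)
    (f : hom A A') (g : hom B B') : hom (A * B) (A' * B') :=
  pair (proj0 A B ;; f) (proj1 A B ;; g).

Definition coprod_map (C : category) (Q : coproducts C) (A A' B B' : C)
    (f : hom A A') (g : hom B B') : hom (A + B) (A' + B') :=
  copair (f ;; inj0 A' B') (g ;; inj1 A' B').

Arguments prod_map {C P A A' B B'} f g.
Arguments coprod_map {C Q A A' B B'} f g.

(* [f ** g] and [f ++ g] are the actions of product and coproduct on maps. *)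
Notation "f ** g" := (prod_map f g) (at level 40, left associativity) : cldc_scope.
Notation "f ++ g" := (coprod_map f g) (right associativity, at level 60) : cldc_scope.

Section ProductIsos.
Context (C : category) (P : products C).
Implicit Types A B D : C.

Definition prodA A B D : hom ((A * B) * D) (A * (B * D)) :=
  pair (proj0 (A * B) D ;; proj0 A B)
       (pair (proj0 (A * B) D ;; proj1 A B) (proj1 (A * B) D)).
Definition prod_runit A : hom A (A * top) := pair (id A) (to_top A).
Definition prod_lunit A : hom A (top * A) := pair (to_top A) (id A).
Definition prod_sym A B : hom (A * B) (B * A) := pair (proj1 A B) (proj0 A B).

Definition prod_runit_inv A : hom (A * top) A := proj0 A top.

Lemma prod_runitK A : prod_runit A ;; prod_runit_inv A = id A.
Proof. apply pair_proj0. Qed.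

Lemma prod_runit_invK A : prod_runit_inv A ;; prod_runit A = id (A * top).
Proof.
transitivity (pair (proj0 A top) (proj1 A top)).
- apply pair_unique; unfold prod_runit, prod_runit_inv; rewrite comp_assoc.
  + now rewrite pair_proj0, comp_idr.
  + rewrite pair_proj1.
    rewrite (to_top_unique (proj1 A top)); apply to_top_unique.
- symmetry; apply pair_unique; apply comp_idl.
Qed.

End ProductIsos.

Section CoproductIsos.
Context (C : category) (Q : coproducts C).
Implicit Types A B D : C.

Definition coprodA A B D : hom (A + (B + D)) ((A + B) + D) :=
  copair (inj0 A B ;; inj0 (A + B) D)
         (copair (inj1 A B ;; inj0 (A + B) D) (inj1 (A + B) D)).
Definition coprod_runit A : hom (A + bot) A := copair (id A) (from_bot A).
Definition coprod_lunit A : hom (bot + A) A := copair (from_bot A) (id A).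
Definition coprod_sym A B : hom (A + B) (B + A) := copair (inj1 B A) (inj0 B A).

Definition coprod_lunit_inv A : hom A (bot + A) := inj1 bot A.

Lemma coprod_lunit_invK A : coprod_lunit_inv A ;; coprod_lunit A = id A.
Proof. apply inj1_copair. Qed.

Lemma coprod_lunitK A : coprod_lunit A ;; coprod_lunit_inv A = id (bot + A).
Proof.
transitivity (copair (inj0 bot A) (inj1 bot A)).
- apply copair_unique; unfold coprod_lunit, coprod_lunit_inv;
    rewrite <- comp_assoc.
  + rewrite inj0_copair.
    rewrite (from_bot_unique (inj0 bot A)); apply from_bot_unique.
  + now rewrite inj1_copair, comp_idl.
- symmetry; apply copair_unique; apply comp_idr.
Qed.

End CoproductIsos.

Arguments prodA {C P} A B D.
Arguments prod_runit {C P} A.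
Arguments prod_lunit {C P} A.
Arguments prod_sym {C P} A B.
Arguments prod_runit_inv {C P} A.
Arguments coprodA {C Q} A B D.
Arguments coprod_runit {C Q} A.
Arguments coprod_lunit {C Q} A.
Arguments coprod_sym {C Q} A B.
Arguments coprod_lunit_inv {C Q} A.

(* Cartesian linearly distributive categories. *)
Record CLDC : Type := MkCLDC {
  cldc_cat :> category;
  cldc_products :: products cldc_cat;
  cldc_coproducts :: coproducts cldc_cat;
  dR : forall A B C : cldc_cat, hom ((A + B) * C) (A + (B * C));
  dL : forall A B C : cldc_cat, hom (A * (B + C)) ((A * B) + C);
  dR_natural : forall (A A' B B' C C' : cldc_cat)
      (f : hom A A') (g : hom B B') (h : hom C C'),
    ((f ++ g) ** h) ;; dR A' B' C' = dR A B C ;; (f ++ (g ** h));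
  dL_natural : forall (A A' B B' C C' : cldc_cat)
      (f : hom A A') (g : hom B B') (h : hom C C'),
    (f ** (g ++ h)) ;; dL A' B' C' = dL A B C ;; ((f ** g) ++ h);
  (* units *)
  dL_top : forall A B : cldc_cat,
    prod_lunit (A + B) ;; dL top A B = prod_lunit A ++ id B;
  dR_top : forall A B : cldc_cat,
    prod_runit (A + B) ;; dR A B top = id A ++ prod_runit B;
  dR_bot : forall A B : cldc_cat,
    dR bot A B ;; coprod_lunit (A * B) = coprod_lunit A ** id B;
  dL_bot : forall A B : cldc_cat,
    dL A B bot ;; coprod_runit (A * B) = id A ** coprod_runit B;
  (* associativities *)
  dL_prodA : forall A B C D : cldc_cat,
    dL (A * B) C D ;; (prodA A B C ++ id D)
    = prodA A B (C + D) ;; (id A ** dL B C D) ;; dL A (B * C) D;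
  dR_coprodA : forall A B C D : cldc_cat,
    (coprodA A B C ** id D) ;; dR (A + B) C D
    = dR A (B + C) D ;; (id A ++ dR B C D) ;; coprodA A B (C * D);
  dL_coprodA : forall A B C D : cldc_cat,
    dL A B (C + D) ;; coprodA (A * B) C D
    = (id A ** coprodA B C D) ;; dL A (B + C) D ;; (dL A B C ++ id D);
  dR_prodA : forall A B C D : cldc_cat,
    prodA (A + B) C D ;; dR A B (C * D)
    = (dR A B C ** id D) ;; dR A (B * C) D ;; (id A ++ prodA B C D);
  (* interaction of the two distributors *)
  dL_dR_coprodA : forall A B C D : cldc_cat,
    dL (A + B) C D ;; (dR A B C ++ id D)
    = dR A B (C + D) ;; (id A ++ dL B C D) ;; coprodA A (B * C) D;
  dL_dR_prodA : forall A B C D : cldc_cat,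
    (dL A B C ** id D) ;; dR (A * B) C D
    = prodA A (B + C) D ;; (id A ** dR B C D) ;; dL A B (C * D);
  (* symmetry *)
  dR_dL_sym : forall A B C : cldc_cat,
    dR A B C
    = prod_sym (A + B) C ;; (id C ** coprod_sym A B) ;; dL C B A
      ;; (prod_sym C B ++ id A) ;; coprod_sym (B * C) A
}.

Arguments dR {c} A B C.
Arguments dL {c} A B C.

Definition bot_to_top (C : CLDC) : hom (bot : C) (top : C) := from_bot top.
Arguments bot_to_top {C}.

Definition mix (C : CLDC) (A B : C) : hom (A * B) (A + B) :=
  (id A ** coprod_lunit_inv B) ;; (id A ** (bot_to_top ++ id B)) ;;
  dL A top B ;; (prod_runit_inv A ++ id B).
Arguments mix {C} A B.

(* Main.v *)
Require Import Defs.

(** The distributor [dL A Z B] is determined on the left summand of [Z + B],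
    where it is the injection.  On the right summand it gives a map
    [skewL A Z B : A * B -> (A * Z) + B] which interpolates between two
    candidates: discarding [Z] turns it into [mix], discarding [A] turns it into
    [proj1 ;; inj1].  Mirroring, [skewR A Z B : A * B -> A + (Z * B)] becomes
    [proj0 ;; inj0] when [B] is discarded.

    If [A] is subterminal then the two projections [A * A -> A] agree, so all
    the ways of discarding a factor agree and [mix A A = proj1 ;; inj1].  The
    coherence between the two distributors, precomposed with injections so that
    only the skew maps remain ([skewL_skewR]), then identifies [proj0 ;; inj0]
    with [proj1 ;; inj1] ([subterminal_cross]).  This equation is very strong:
    precomposing with the diagonal gives [inj0 = inj1], so that [A] is
    preinitial, and postcomposing with the codiagonal gives [proj0 = proj1], so
    that [A] is subterminal.

    The remaining implication, from preinitial to subterminal, is the one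
    just described in the opposite category: reversing arrows exchanges
    products with coproducts and [dL] with [dR], and the axioms of a cartesian
    linearly distributive category are stable under this exchange. *)

(** * Calculus of products and coproducts *)

Section Products.
Context (C : category) (P : products C).

Lemma pair_ext (X A B : C) (f g : hom X (A * B)) :
  f ;; proj0 A B = g ;; proj0 A B -> f ;; proj1 A B = g ;; proj1 A B -> f = g.
Proof.
intros h0 h1; rewrite (pair_unique h0 h1); symmetry; now apply pair_unique.
Qed.

Lemma prod_map_proj0 (A A' B B' : C) (f : hom A A') (g : hom B B') :
  (f ** g) ;; proj0 A' B' = proj0 A B ;; f.
Proof. apply pair_proj0. Qed.

Lemma prod_map_proj1 (A A' B B' : C) (f : hom A A') (g : hom B B') :
  (f ** g) ;; proj1 A' B' = proj1 A B ;; g.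
Proof. apply pair_proj1. Qed.

Lemma prod_map_comp (A A' A'' B B' B'' : C)
    (f : hom A A') (f' : hom A' A'') (g : hom B B') (g' : hom B' B'') :
  (f ** g) ;; (f' ** g') = (f ;; f') ** (g ;; g').
Proof.
apply pair_ext; rewrite comp_assoc.
- now rewrite !prod_map_proj0, <- !comp_assoc, prod_map_proj0.
- now rewrite !prod_map_proj1, <- !comp_assoc, prod_map_proj1.
Qed.

Lemma prod_map_id (A B : C) : id A ** id B = id (A * B).
Proof.
apply pair_ext.
- now rewrite prod_map_proj0, comp_idl, comp_idr.
- now rewrite prod_map_proj1, comp_idl, comp_idr.
Qed.

Lemma prod_symK (A B : C) : prod_sym A B ;; prod_sym B A = id (A * B).
Proof.
unfold prod_sym; apply pair_ext; rewrite comp_assoc, comp_idl.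
- now rewrite pair_proj0, pair_proj1.
- now rewrite pair_proj1, pair_proj0.
Qed.

Lemma proj_eq_subterminal (A : C) : proj0 A A = proj1 A A -> subterminal A.
Proof.
intros e X f g; rewrite <- (pair_proj0 f g), e; apply pair_proj1.
Qed.

End Products.

Section Coproducts.
Context (C : category) (Q : coproducts C).

Lemma copair_ext (A B X : C) (f g : hom (A + B) X) :
  inj0 A B ;; f = inj0 A B ;; g -> inj1 A B ;; f = inj1 A B ;; g -> f = g.
Proof.
intros h0 h1; rewrite (copair_unique h0 h1); symmetry; now apply copair_unique.
Qed.

Lemma inj0_coprod_map (A A' B B' : C) (f : hom A A') (g : hom B B') :
  inj0 A B ;; (f ++ g) = f ;; inj0 A' B'.
Proof. apply inj0_copair. Qed.

Lemma inj1_coprod_map (A A' B B' : C) (f : hom A A') (g : hom B B') :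
  inj1 A B ;; (f ++ g) = g ;; inj1 A' B'.
Proof. apply inj1_copair. Qed.

Lemma coprod_map_comp (A A' A'' B B' B'' : C)
    (f : hom A A') (f' : hom A' A'') (g : hom B B') (g' : hom B' B'') :
  (f ++ g) ;; (f' ++ g') = (f ;; f') ++ (g ;; g').
Proof.
apply copair_ext; rewrite <- comp_assoc.
- now rewrite !inj0_coprod_map, !comp_assoc, inj0_coprod_map.
- now rewrite !inj1_coprod_map, !comp_assoc, inj1_coprod_map.
Qed.

Lemma coprod_map_id (A B : C) : id A ++ id B = id (A + B).
Proof.
apply copair_ext.
- now rewrite inj0_coprod_map, comp_idl, comp_idr.
- now rewrite inj1_coprod_map, comp_idl, comp_idr.
Qed.

Lemma coprod_map_compl (A A' A'' B : C) (f : hom A A') (f' : hom A' A'') :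
  (f ;; f') ++ id B = (f ++ id B) ;; (f' ++ id B).
Proof. now rewrite coprod_map_comp, comp_idl. Qed.

Lemma coprod_map_compr (A B B' B'' : C) (g : hom B B') (g' : hom B' B'') :
  id A ++ (g ;; g') = (id A ++ g) ;; (id A ++ g').
Proof. now rewrite coprod_map_comp, comp_idl. Qed.

Lemma coprod_symK (A B : C) : coprod_sym A B ;; coprod_sym B A = id (A + B).
Proof.
unfold coprod_sym; apply copair_ext; rewrite <- comp_assoc, comp_idr.
- now rewrite inj0_copair, inj1_copair.
- now rewrite inj1_copair, inj0_copair.
Qed.

Lemma inj0_coprodA (A B D : C) :
  inj0 A (B + D) ;; coprodA A B D = inj0 A B ;; inj0 (A + B) D.
Proof. apply inj0_copair. Qed.

Lemma inj1_coprodA (A B D : C) :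
  inj1 A (B + D) ;; coprodA A B D = inj1 A B ++ id D.
Proof. unfold coprodA, coprod_map; now rewrite inj1_copair, comp_idl. Qed.

Lemma coprodA_natural (A A' B B' D D' : C)
    (f : hom A A') (g : hom B B') (h : hom D D') :
  coprodA A B D ;; ((f ++ g) ++ h) = (f ++ (g ++ h)) ;; coprodA A' B' D'.
Proof.
apply copair_ext; rewrite <- !comp_assoc.
- rewrite inj0_coprodA, inj0_coprod_map, !comp_assoc, inj0_coprodA.
  now rewrite inj0_coprod_map, <- !comp_assoc, inj0_coprod_map.
- rewrite inj1_coprodA, inj1_coprod_map, !comp_assoc, inj1_coprodA.
  now rewrite !coprod_map_comp, inj1_coprod_map, comp_idl, comp_idr.
Qed.

End Coproducts.

(** * Cancelling a factor after a distributor *)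

Section Skew.
Context (C : CLDC).
Implicit Types A B D Z : C.

(** By naturality in the first factor it suffices to treat the terminal object,
    where this is the unit law of [dL]. *)
Lemma dL_proj1 A B D : dL A B D ;; (proj1 A B ++ id D) = proj1 A (B + D).
Proof.
assert (unit : dL top B D ;; (proj1 top B ++ id D) = proj1 top (B + D)).
{ assert (e : proj1 top (B + D) ;; prod_lunit (B + D) = id _).
  { apply pair_ext; unfold prod_lunit; rewrite comp_assoc.
    - rewrite pair_proj0, (to_top_unique (proj1 _ _ ;; _)).
      symmetry; apply to_top_unique.
    - now rewrite pair_proj1, comp_idl, comp_idr. }
  rewrite <- (comp_idl (dL top B D ;; _)), <- e.
  rewrite !comp_assoc, <- (comp_assoc (prod_lunit _)), dL_top.
  rewrite coprod_map_comp; unfold prod_lunit at 1.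
  now rewrite pair_proj1, comp_idl, coprod_map_id, comp_idr. }
assert (p : proj1 A B = (to_top A ** id B) ;; proj1 top B).
{ now rewrite prod_map_proj1, comp_idr. }
rewrite p, coprod_map_compl, <- comp_assoc.
rewrite <- dL_natural, comp_assoc, unit, prod_map_proj1.
now rewrite coprod_map_id, comp_idr.
Qed.

Lemma dR_proj0 A B D : dR A B D ;; (id A ++ proj0 B D) = proj0 (A + B) D.
Proof.
assert (unit : dR A B top ;; (id A ++ proj0 B top) = proj0 (A + B) top).
{ rewrite <- (comp_idl (dR A B top ;; _)), <- prod_runit_invK.
  rewrite !comp_assoc, <- (comp_assoc (prod_runit _)), dR_top.
  rewrite coprod_map_comp; unfold prod_runit at 1.
  now rewrite pair_proj0, comp_idl, coprod_map_id, comp_idr. }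
assert (p : proj0 B D = (id B ** to_top D) ;; proj0 B top).
{ now rewrite prod_map_proj0, comp_idr. }
rewrite p, coprod_map_compr, <- comp_assoc.
rewrite <- dR_natural, comp_assoc, unit, prod_map_proj0.
now rewrite coprod_map_id, comp_idr.
Qed.

Definition skewL A Z B : hom (A * B) ((A * Z) + B) :=
  (id A ** inj1 Z B) ;; dL A Z B.

Definition skewR A Z B : hom (A * B) (A + (Z * B)) :=
  (inj0 A Z ** id B) ;; dR A Z B.

Lemma skewL_proj1 A Z B :
  skewL A Z B ;; (proj1 A Z ++ id B) = proj1 A B ;; inj1 Z B.
Proof. unfold skewL; now rewrite comp_assoc, dL_proj1, prod_map_proj1. Qed.

Lemma skewR_proj0 A Z B :
  skewR A Z B ;; (id A ++ proj0 Z B) = proj0 A B ;; inj0 A Z.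
Proof. unfold skewR; now rewrite comp_assoc, dR_proj0, prod_map_proj0. Qed.

(** The definition of [mix] is the case of the terminal object, entered through
    the initial one; since [Z] is discarded in the end, naturality allows any
    object in its place. *)
Lemma skewL_proj0 A Z B : skewL A Z B ;; (proj0 A Z ++ id B) = mix A B.
Proof.
assert (p : proj0 A Z = (id A ** to_top Z) ;; proj0 A top).
{ now rewrite prod_map_proj0, comp_idr. }
rewrite p, coprod_map_compl.
unfold skewL, mix, prod_runit_inv, coprod_lunit_inv.
rewrite <- comp_assoc, (comp_assoc (id A ** inj1 Z B)), <- dL_natural.
rewrite <- comp_assoc, !prod_map_comp.
now rewrite !inj1_coprod_map, !comp_idl.
Qed.

(** This is the coherence between [dL] and [dR] on [(A + B) * (Z + D)],
    precomposed with [inj0 A B ** inj1 Z D]. *)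
Lemma skewL_skewR A B Z D :
  skewL A Z D ;; (skewR A B Z ++ id D)
  = skewR A B D ;; (id A ++ skewL B Z D) ;; coprodA A (B * Z) D.
Proof.
transitivity ((inj0 A B ** inj1 Z D) ;; dL (A + B) Z D ;; (dR A B Z ++ id D)).
- unfold skewL, skewR.
  rewrite coprod_map_compl, <- comp_assoc.
  rewrite (comp_assoc (id A ** inj1 Z D)), <- dL_natural.
  rewrite <- comp_assoc, prod_map_comp.
  now rewrite coprod_map_id, comp_idl, comp_idr.
- rewrite comp_assoc, dL_dR_coprodA, <- !comp_assoc; f_equal.
  unfold skewL, skewR.
  rewrite coprod_map_compr, <- comp_assoc.
  rewrite (comp_assoc (inj0 A B ** id D)), <- dR_natural.
  rewrite <- comp_assoc, prod_map_comp.
  now rewrite coprod_map_id, comp_idl, comp_idr.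
Qed.

(** * Subterminal objects *)

Lemma subterminal_mix A : subterminal A -> mix A A = proj1 A A ;; inj1 A A.
Proof.
intros sA.
rewrite <- (skewL_proj0 A A A), (sA _ (proj0 A A) (proj1 A A)).
apply skewL_proj1.
Qed.

(** Discarding the first factor of the middle summand [A * A] in [skewL_skewR]
    makes each side factor through one injection into [(A + A) + A]: the left
    side through the last summand, the right side through the first. *)
Lemma subterminal_cross A :
  subterminal A -> proj0 A A ;; inj0 A A = proj1 A A ;; inj1 A A.
Proof.
intros sA; pose proof (sA _ (proj0 A A) (proj1 A A)) as e.
assert (skewR_eq : skewR A A A ;; (id A ++ proj1 A A) = proj0 A A ;; inj0 A A).
{ rewrite <- e; apply skewR_proj0. }
assert (step : proj0 A A ;; inj0 A A ;; inj0 (A + A) A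
               = proj1 A A ;; inj1 (A + A) A).
{ pose proof (f_equal (fun u => u ;; ((id A ++ proj1 A A) ++ id A))
                (skewL_skewR A A A A)) as h; cbv beta in h.
  rewrite comp_assoc, coprod_map_comp, comp_idl, skewR_eq in h.
  rewrite coprod_map_compl, <- comp_assoc, skewL_proj0 in h.
  rewrite (subterminal_mix _ sA) in h.
  rewrite comp_assoc, inj1_coprod_map, comp_idl in h.
  rewrite comp_assoc, coprodA_natural, <- comp_assoc in h.
  rewrite (comp_assoc (skewR A A A)), <- coprod_map_compr, skewL_proj1 in h.
  rewrite coprod_map_compr, <- comp_assoc, skewR_eq in h.
  rewrite h, !comp_assoc, <- (comp_assoc (inj0 A A)), inj0_coprod_map, comp_idl.
  now rewrite inj0_coprodA. }
(* Fold the first two summands together to come back to [A + A]. *)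
pose proof (f_equal (fun u => u ;; (copair (id A) (id A) ++ id A)) step) as h.
cbv beta in h; rewrite !comp_assoc, inj0_coprod_map, inj1_coprod_map in h.
now rewrite comp_idl, <- (comp_assoc (inj0 A A)), inj0_copair, comp_idl in h.
Qed.

Lemma cross_subterminal A :
  proj0 A A ;; inj0 A A = proj1 A A ;; inj1 A A -> subterminal A.
Proof.
intros e; apply (proj_eq_subterminal _ _ A).
apply (f_equal (fun u => u ;; copair (id A) (id A))) in e.
now rewrite !comp_assoc, inj0_copair, inj1_copair, !comp_idr in e.
Qed.

Lemma cross_preinitial A :
  proj0 A A ;; inj0 A A = proj1 A A ;; inj1 A A -> preinitial A.
Proof.
intros e X f g.
apply (f_equal (fun u => pair (id A) (id A) ;; u ;; copair f g)) in e.
rewrite <- !comp_assoc, pair_proj0, pair_proj1, !comp_idl in e.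
now rewrite inj0_copair, inj1_copair in e.
Qed.

Lemma subterminal_preinitial A : subterminal A -> preinitial A.
Proof. intros sA; apply cross_preinitial, subterminal_cross, sA. Qed.

End Skew.

(** * The opposite of a cartesian linearly distributive category *)

(** The bracketing is that of the symmetry axiom read with arrows reversed. *)
Lemma dL_dR_sym (C : CLDC) (A B D : C) :
  dL A B D
  = prod_sym A (B + D) ;; ((coprod_sym B D ** id A) ;; (dR D B A ;;
      ((id D ++ prod_sym B A) ;; coprod_sym D (A * B)))).
Proof.
assert (swap_prod : prod_sym A (B + D) ;; (coprod_sym B D ** id A)
            = (id A ** coprod_sym B D) ;; prod_sym A (D + B)).
{ unfold prod_sym; apply pair_ext; rewrite !comp_assoc.
  - rewrite prod_map_proj0, <- comp_assoc, !pair_proj0.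
    now rewrite prod_map_proj1.
  - rewrite prod_map_proj1, <- comp_assoc, !pair_proj1.
    now rewrite prod_map_proj0, comp_idr. }
assert (swap_coprod : (id D ++ prod_sym B A) ;; coprod_sym D (A * B)
            = coprod_sym D (B * A) ;; (prod_sym B A ++ id D)).
{ unfold coprod_sym; apply copair_ext; rewrite <- !comp_assoc.
  - rewrite inj0_coprod_map, comp_assoc, !inj0_copair.
    now rewrite inj1_coprod_map.
  - rewrite inj1_coprod_map, comp_assoc, !inj1_copair.
    now rewrite inj0_coprod_map. }
rewrite <- comp_assoc, swap_prod, swap_coprod, dR_dL_sym.
rewrite !comp_assoc, <- (comp_assoc (prod_sym A (D + B))), prod_symK, comp_idl.
rewrite <- (comp_assoc (coprod_sym (B * A) D)), coprod_symK, comp_idl.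
rewrite coprod_map_comp, prod_symK, comp_idl, coprod_map_id, comp_idr.
rewrite <- comp_assoc, prod_map_comp, coprod_symK, comp_idl.
now rewrite prod_map_id, comp_idl.
Qed.

Definition op_category (C : category) : category :=
  {| obj := obj C;
     hom := fun A B => @hom C B A;
     id := fun A => @id C A;
     comp := fun A B D f g => @comp C D B A g f;
     comp_idl := fun A B f => comp_idr f;
     comp_idr := fun A B f => comp_idl f;
     comp_assoc := fun A B D E f g h => eq_sym (comp_assoc h g f) |}.

Definition op_products (C : category) (Q : coproducts C) :
    products (op_category C) :=
  @Products (op_category C) (@bot C Q) (@from_bot C Q) (@from_bot_unique C Q)
    (@coprod C Q) (@inj0 C Q) (@inj1 C Q)
    (fun X A B f g => @copair C Q A B X f g)
    (fun X A B f g => @inj0_copair C Q A B X f g)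
    (fun X A B f g => @inj1_copair C Q A B X f g)
    (fun X A B f g h => @copair_unique C Q A B X f g h).

Definition op_coproducts (C : category) (P : products C) :
    coproducts (op_category C) :=
  @Coproducts (op_category C) (@top C P) (@to_top C P) (@to_top_unique C P)
    (@prod C P) (@proj0 C P) (@proj1 C P)
    (fun A B X f g => @pair C P X A B f g)
    (fun A B X f g => @pair_proj0 C P X A B f g)
    (fun A B X f g => @pair_proj1 C P X A B f g)
    (fun A B X f g h => @pair_unique C P X A B f g h).

(** Each axiom of the opposite is, up to the bracketing of composites, an axiom
    of [C]: the unit laws for [top] become those for [bot], the associativities
    for products become those for coproducts, and the two coherences between
    [dL] and [dR] are exchanged.  Only the symmetry law changes form: it becomes
    [dL_dR_sym], which follows because the symmetries are involutions. *)
Definition op_CLDC (C : CLDC) : CLDC.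
Proof.
refine (@MkCLDC (op_category C) (op_products _ (cldc_coproducts C))
          (op_coproducts _ (cldc_products C))
          (fun A B D : C => dL A B D) (fun A B D : C => dR A B D)
          _ _ _ _ _ _ _ _ _ _ _ _ _).
- intros; exact (eq_sym (@dL_natural C _ _ _ _ _ _ f g h)).
- intros; exact (eq_sym (@dR_natural C _ _ _ _ _ _ f g h)).
- exact (@dR_bot C).
- exact (@dL_bot C).
- exact (@dL_top C).
- exact (@dR_top C).
- intros; exact (eq_trans (@dR_coprodA C A B C0 D) (comp_assoc _ _ _)).
- intros; exact (eq_trans (@dL_prodA C A B C0 D) (comp_assoc _ _ _)).
- intros; exact (eq_trans (@dR_prodA C A B C0 D) (comp_assoc _ _ _)).
- intros; exact (eq_trans (@dL_coprodA C A B C0 D) (comp_assoc _ _ _)).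
- intros; exact (eq_trans (@dL_dR_prodA C A B C0 D) (comp_assoc _ _ _)).
- intros; exact (eq_trans (@dL_dR_coprodA C A B C0 D) (comp_assoc _ _ _)).
- exact (@dL_dR_sym C).
Defined.

Lemma preinitial_subterminal (C : CLDC) (A : C) : preinitial A -> subterminal A.
Proof. exact (@subterminal_preinitial (op_CLDC C) A). Qed.

(** * The equivalence *)

Theorem proposition3p10 (C : CLDC) (A : C) :
  (preinitial A <-> subterminal A) /\
  (subterminal A <->
     proj0 A A ;; inj0 A A = mix A A /\ mix A A = proj1 A A ;; inj1 A A).
Proof.
split; split.
- apply preinitial_subterminal.
- apply subterminal_preinitial.
- intros sA; rewrite (subterminal_mix _ _ sA).
  now split; [apply subterminal_cross|].
- intros [e0 e1]; apply cross_subterminal; now rewrite e0.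
Qed.
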